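(* For every positive integer $k$ and every positive integer $n$, there is a graph $U_{k,n}$ of pathwidth at most $k^2+k-1$ with at most $n^{k+1}$ vertices that contains every $n$-vertex graph of pathwidth at most $k$ as a subgraph.
   Context: ''$U$ contains $H$ as a subgraph'' means $U$ has a subgraph isomorphic to $H$. Pathwidth is the usual notion: the minimum, over path-decompositions, of the maximum bag size minus one. *)

(* Defs.v *)
From HB Require Import structures.
From mathcomp Require Import all_boot boolp.
Set Implicit Arguments.
Unset Strict Implicit.
Unset Printing Implicit Defensive.

Record sgraph := SGraph {
  vertex :> finType;
  edge : rel vertex;
  edge_sym : symmetric edge;
  edge_irrefl : irreflexive edge }.

Definition isomorphic (G H : sgraph) : Prop :=
  exists2 f : G -> H, bijective f & forall x y, edge (f x) (f y) = edge x y.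

(* A subgraph of U need not be induced: any set of vertices together with any
   set of edges of U between them. *)
Record subgraph (U : sgraph) := Subgraph {
  sub_vertex : {set U};
  sub_edge : rel U;
  sub_edge_sym : symmetric sub_edge;
  sub_edge_vertex :
    forall x y, sub_edge x y -> (x \in sub_vertex) && (y \in sub_vertex);
  sub_edge_edge : subrel sub_edge (@edge U) }.

Section SubgraphAsGraph.
Variables (U : sgraph) (S : subgraph U).

Definition sgraph_edge : rel {x | x \in sub_vertex S} :=
  fun x y => sub_edge S (val x) (val y).

Lemma sgraph_edge_sym : symmetric sgraph_edge.
Proof. by move=> x y; exact: sub_edge_sym. Qed.

Lemma sgraph_edge_irrefl : irreflexive sgraph_edge.
Proof.
move=> x; apply/negP => /(@sub_edge_edge _ S).
by rewrite edge_irrefl.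
Qed.

Definition sgraph_of_subgraph : sgraph :=
  SGraph sgraph_edge_sym sgraph_edge_irrefl.

End SubgraphAsGraph.

Definition contains_subgraph (U H : sgraph) : Prop :=
  exists S : subgraph U, isomorphic (sgraph_of_subgraph S) H.

(* The bags are listed in the order of the nodes of the underlying path; the
   last clause says that the nodes whose bags contain v induce a subpath. *)
Definition path_decomposition (G : sgraph) (B : seq {set G}) : Prop :=
  [/\ forall v : G, exists2 A, A \in B & v \in A,
      forall u v : G, edge u v -> exists2 A, A \in B & (u \in A) && (v \in A)
    & forall (v : G) (i j l : nat), i <= j -> j <= l -> l < size B ->
        v \in nth set0 B i -> v \in nth set0 B l -> v \in nth set0 B j].

(* Because of the truncated predecessor, the graph without vertices gets
   width 0 rather than -1. *)
Definition width (G : sgraph) (B : seq {set G}) : nat :=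
  (\max_(A <- B) #|A|).-1.

Definition has_width (G : sgraph) (w : nat) : bool :=
  `[< exists2 B : seq {set G}, path_decomposition B & width B = w >].

Lemma has_width_ex (G : sgraph) : exists w, has_width G w.
Proof.
exists (width [:: [set: G]]); apply/asboolP; exists [:: [set: G]] => //; split.
- by move=> v; exists [set: G]; rewrite ?inE.
- by move=> u v _; exists [set: G]; rewrite ?inE.
- by move=> v i j l _ le_jl; case: l le_jl => // /[!leqn0] /eqP-> _ _; rewrite inE.
Qed.

Definition pathwidth (G : sgraph) : nat := ex_minn (has_width_ex G).

(* Main.v *)
Require Import Defs.
From mathcomp Require Import all_boot boolp zify.

Set Implicit Arguments.
Unset Strict Implicit.
Unset Printing Implicit Defensive.

(* Represent a graph of pathwidth at most [k] by vertex intervals [l v, r v]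
   with distinct left ends, at most [k.+1] of them through any time, and argue by
   induction on [k]. Cut the line greedily: given the set of intervals crossing
   the current cut, let [x] be the one that ends last and cut next at its end.
   The successive crossing sets are disjoint and have at most [k] elements, as
   [x] shares a bag with the next one. The other vertices between two cuts lie
   under [x], hence induce pathwidth at most [k.-1], and are adjacent only to the
   two surrounding crossing sets. So a path of [n] spine cliques on [k] vertices,
   consecutive ones completely joined, with a copy of the universal graph for
   [k.-1] and [n.-1] hung between consecutive cliques, is universal.

   If a crossing set has [k] elements, the one that starts last meets no vertex
   under [x], since it would meet [x] and the rest of the set there as well.
   Thus a copy need not be joined to the last vertex of the next clique, which
   gives pathwidth [k ^ 2] and lets the induction start at edgeless graphs. *)

(** * Path decompositions as families of intervals *)

Definition bag (V : finType) (l r : V -> nat) (W : {set V}) (t : nat) : {set V} :=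
  [set v in W | l v <= t <= r v].

(** For symmetric [e] the second clause applies in both orders, so adjacent vertices have
    intersecting intervals. Working relative to [W] lets the induction pass to subsets without
    forming induced subgraphs. *)
Definition interval_model (V : finType) (e : rel V) (l r : V -> nat)
    (W : {set V}) (b : nat) : Prop :=
  [/\ {in W, forall v, l v <= r v},
      {in W &, forall u v, e u v -> l u <= r v}
    & forall t, #|bag l r W t| <= b].

Definition embedding (V : finType) (T : Type) (e : rel V) (e' : rel T)
    (W : {set V}) (f : V -> T) : Prop :=
  {in W &, injective f} /\ {in W &, forall u v, e u v -> e' (f u) (f v)}.

Lemma pathwidth_leq (G : sgraph) (l r : G -> nat) (b : nat) :
  interval_model (@edge G) l r [set: G] b -> pathwidth G <= b.-1.
Proof.
case=> lr elr cb.
pose M := (\max_v r v).+1.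
have rM v : r v < M by rewrite ltnS; exact: (leq_bigmax v).
pose B := [seq bag l r [set: G] t | t <- iota 0 M].
have bagB t : t < M -> bag l r [set: G] t \in B.
  by move=> tM; apply/mapP; exists t; rewrite // mem_iota.
have decB : path_decomposition B.
  split.
  - move=> v; exists (bag l r [set: G] (r v)); first exact: bagB.
    by rewrite !inE leqnn lr ?inE.
  - move=> u v uv; have vu : edge v u by rewrite edge_sym.
    (* Two intersecting intervals are both alive at the earlier of their right ends. *)
    exists (bag l r [set: G] (minn (r u) (r v))).
      by apply: bagB; rewrite gtn_min rM.
    have := elr u v (in_setT _) (in_setT _) uv.
    have := elr v u (in_setT _) (in_setT _) vu.
    have := lr u (in_setT _); have := lr v (in_setT _).
    by rewrite !inE; lia.
  - move=> v i j t ij jt; rewrite size_map size_iota => tM.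
    have nthB s : s < M -> nth set0 B s = bag l r [set: G] s.
      by move=> sM; rewrite (nth_map 0) ?size_iota // nth_iota.
    rewrite !nthB ?inE; lia.
have wB : width B <= b.-1.
  have: \max_(A <- B) #|A| <= b.
    apply/bigmax_leqP_seq => A /mapP[t _ ->] _; exact: cb.
  rewrite /width; lia.
rewrite /pathwidth; case: ex_minnP => w _ minw; apply: leq_trans wB.
by apply: minw; apply/asboolP; exists B.
Qed.

Lemma interval_model_of_pathwidth (G : sgraph) (k : nat) :
  pathwidth G <= k ->
  exists l r : G -> nat,
    injective l /\ interval_model (@edge G) l r [set: G] k.+1.
Proof.
rewrite /pathwidth; case: ex_minnP => w /asboolP[B [coverB edgeB convB] wB] _ wk.
have bagB t : #|nth set0 B t| <= k.+1.
  have [tB|tB] := ltnP t (size B); last by rewrite nth_default ?cards0.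
  have : #|nth set0 B t| <= \max_(A <- B) #|A|.
    by apply: leq_bigmax_seq => //; apply: mem_nth.
  by move: wk; rewrite -wB /width; lia.
(* The interval of [v] runs from the first bag containing it to the last one. *)
pose l v := find (fun A : {set G} => v \in A) B.
pose r v := \max_(i < size B | v \in nth set0 B i) i.
have ler v t : t < size B -> v \in nth set0 B t -> t <= r v.
  by move=> tB vt; apply: (@leq_bigmax_cond _ _ (fun i : 'I__ => i : nat) (Ordinal tB)).
have lel v t : t < size B -> v \in nth set0 B t -> l v <= t.
  by move=> tB; apply: contraTT; rewrite -ltnNge => /(before_find set0)->.
have hasv v : has (fun A : {set G} => v \in A) B.
  by have [A AB vA] := coverB v; apply/hasP; exists A.
have lB v : l v < size B by rewrite -has_find.
have vl v : v \in nth set0 B (l v) by exact: (nth_find set0 (hasv v)).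
have lr v : l v <= r v by exact: ler.
have vr v : r v < size B /\ v \in nth set0 B (r v).
  have : 0 < #|[pred i : 'I_(size B) | v \in nth set0 B i]|.
    by apply/card_gt0P; exists (Ordinal (lB v)); exact: vl.
  by case/(eq_bigmax_cond (fun i : 'I__ => i : nat)) => i vi; rewrite -/(r v) /r => ->.
have inbag v t : l v <= t <= r v -> v \in nth set0 B t.
  by case/andP=> lt tr; have [rB vrv] := vr v; apply: convB lt tr rB _ _.
pose n := #|G|; pose rk (v : G) : nat := enum_rank v.
have rkn v : rk v < n by exact: ltn_ord.
(* Each bag is stretched over [n] consecutive times. Delaying [v] by its rank inside its first
   stretch separates the left ends; intervals end with their last stretch, so vertices sharing a bag
   still meet, and time [t] sees only vertices of bag [t %/ n]. *)
exists (fun v => l v * n + rk v), (fun v => r v * n + n.-1); split.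
  move=> u v luv; have n0 : 0 < n by apply: leq_trans (rkn u).
  apply/enum_rank_inj/val_inj; rewrite /= -/(rk u) -/(rk v).
  by rewrite -[LHS](modn_small (rkn u)) -[RHS](modn_small (rkn v)) -(modnMDl (l u)) luv modnMDl.
split.
- move=> v _; have := rkn v; have := leq_mul (lr v) (leqnn n); lia.
- move=> u v _ _ uv; have [A /(nthP set0)[t tB <-] /andP[ut vt]] := edgeB _ _ uv.
  have luv : l u <= r v by apply: leq_trans (lel _ _ tB ut) (ler _ _ tB vt).
  have := rkn u; have := leq_mul luv (leqnn n); lia.
- move=> t; apply: leq_trans (bagB (t %/ n)); apply: subset_leq_card.
  apply/subsetP=> v; rewrite !inE /= => /andP[lt tr].
  have n0 : 0 < n by apply: leq_trans (rkn v).
  apply: inbag; rewrite leq_divRL // -(ltnS _ (r v)) ltn_divLR // mulSn.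
  by move: lt tr (rkn v); lia.
Qed.

Lemma contains_subgraph_of_embedding (U G : sgraph) (f : G -> U) :
  embedding (@edge G) (@edge U) [set: G] f -> contains_subgraph U G.
Proof.
case=> injf homf.
have f_inj : injective f by move=> u v; apply: injf; rewrite inE.
(* Only images of edges are kept: [f] may send non-edges to edges of [U], while an isomorphism must
   reflect edges. *)
pose e x y := [exists u, exists v, [&& edge u v, x == f u & y == f v]].
have eP x y : reflect (exists u v : G, [/\ edge u v, x = f u & y = f v]) (e x y).
  apply: (iffP existsP) => [[u /existsP[v /and3P[uv /eqP-> /eqP->]]]|[u [v [uv -> ->]]]].
    by exists u, v.
  by exists u; apply/existsP; exists v; rewrite uv !eqxx.
have e_sym : symmetric e.
  by move=> x y; apply/eP/eP => -[u [v [uv -> ->]]]; exists v, u; rewrite edge_sym.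
have e_vertex x y : e x y -> (x \in f @: [set: G]) && (y \in f @: [set: G]).
  by case/eP=> u [v [_ -> ->]]; rewrite !imset_f ?inE.
have e_edge : subrel e (@edge U).
  by move=> x y /eP[u [v [uv -> ->]]]; apply: homf; rewrite ?inE.
exists (Subgraph e_sym e_vertex e_edge).
have fP v : f v \in f @: [set: G] by rewrite imset_f ?inE.
pose g v : {x | x \in f @: [set: G]} := exist _ (f v) (fP v).
have g_inj : injective g by move=> u v [/f_inj].
have g_surj (x : {x | x \in f @: [set: G]}) : exists v, x == g v.
  by case: x => x xf; have /imsetP[v _ xv] := xf; exists v; apply/eqP/val_inj.
pose h x := xchoose (g_surj x).
have hK : cancel h g by move=> x; have /eqP := xchooseP (g_surj x).
have gK : cancel g h by move=> v; apply: g_inj; rewrite hK.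
exists h; first by exists g.
move=> x y; rewrite -{2}[x]hK -{2}[y]hK /= /sgraph_edge /=.
apply/idP/eP => [xy|[u [v [uv /f_inj-> /f_inj->]]]] //.
by exists (h x), (h y).
Qed.

(** * The host graph: a path of blocks *)

Section Blocks.
Variables (k : nat) (H : sgraph).

(** Here [k] is one less than the width of the graphs to be embedded, so a spine has [k.+1]
    vertices. *)
Definition block_vertex : Type := ('I_k.+1 + H)%type.

(* Blocks are indexed by the first component. A block consists of a spine clique
   [inl a] and a copy of [H]; the copy misses the last vertex of the next spine. *)
Definition block_edge (p q : nat * block_vertex) : bool :=
  match p.2, q.2 with
  | inl a, inl b =>
      [|| (p.1 == q.1) && (a != b), p.1 == q.1.+1 | q.1 == p.1.+1]
  | inl a, inr _ => (p.1 == q.1) || (p.1 == q.1.+1) && (a < k)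
  | inr _, inl b => (q.1 == p.1) || (q.1 == p.1.+1) && (b < k)
  | inr h, inr h' => (p.1 == q.1) && edge h h'
  end.

Lemma block_edge_sym : symmetric block_edge.
Proof.
move=> [i [a|h]] [j [b|h']] //=; rewrite /block_edge /=.
  by rewrite eq_sym [a == b]eq_sym; congr (_ || _); rewrite orbC.
by rewrite eq_sym edge_sym.
Qed.

Lemma block_edge_irrefl : irreflexive block_edge.
Proof.
move=> [i [a|h]] //=; rewrite /block_edge /=.
  by rewrite !eqxx; lia.
by rewrite edge_irrefl andbF.
Qed.

Variable n : nat.

(** The first [n] blocks of an infinite strip; the greedy embedding works in the strip, where block
    indices can be shifted freely. *)
Definition blocks_edge : rel ('I_n * ('I_k.+1 + H)) :=
  fun p q => block_edge (val p.1, p.2) (val q.1, q.2).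

Lemma blocks_edge_sym : symmetric blocks_edge.
Proof. by move=> p q; exact: block_edge_sym. Qed.

Lemma blocks_edge_irrefl : irreflexive blocks_edge.
Proof. by move=> p; exact: block_edge_irrefl. Qed.

Definition blocks : sgraph := SGraph blocks_edge_sym blocks_edge_irrefl.

Lemma card_blocks : #|blocks| = n * (k.+1 + #|H|).
Proof. by rewrite card_prod card_sum !card_ord. Qed.

Lemma card_in_block (i : nat) (D : {set 'I_k.+1 + H}) :
  #|[set p : blocks | (val p.1 == i) && (p.2 \in D)]| <= #|D|.
Proof.
rewrite -(@card_in_imset blocks _ (fun p => p.2)) => [|[i1 x] [i2 y]].
  by apply/subset_leq_card/subsetP => _ /imsetP[p + ->]; rewrite inE => /andP[].
rewrite !inE /= => /andP[/eqP i1i _] /andP[/eqP i2i _] ->.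
by congr pair; apply: val_inj; rewrite /= i1i.
Qed.

(** While a copy of [H] is alive, a bag holds at most its spine, [b] vertices of the copy and the
    [k] vertices of the next spine that are joined to the copy. *)
Lemma blocks_interval_model (l r : H -> nat) (b : nat) :
  0 < b -> interval_model (@edge H) l r [set: H] b ->
  exists l' r' : blocks -> nat,
    interval_model (@edge blocks) l' r' [set: blocks] (k.+1 + b + k).
Proof.
move=> b0 [lr elr cb].
pose M := (\max_h r h).+1; pose P := M.+1.
have rM h : r h < M by rewrite ltnS; exact: (leq_bigmax h).
have PE : P = M.+1 by [].
have mulP i j : i < j -> i * P + P <= j * P.
  by move=> ij; rewrite addnC -mulSn leq_mul2r ij orbT.
(* Time [i * P + M] is reserved for the overlap of the last vertex of spine
   [i.+1] with spine [i]; the copy of [H] in block [i] has ended by then. *)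
pose l' (p : blocks) := match p.2 with
  | inl a => p.1 * P - (if a < k then P else 1)
  | inr h => p.1 * P + l h end.
pose r' (p : blocks) := match p.2 with
  | inl a => p.1 * P + M
  | inr h => p.1 * P + r h end.
have lr' h : l h <= r h by apply: lr; rewrite inE.
exists l', r'; split.
- by move=> [i [a|h]] _; rewrite /l' /r' /=; [lia | rewrite leq_add2l].
- move=> [i x] [j y] _ _; rewrite /= /blocks_edge /block_edge /l' /r' /=.
  have := rM; case: x => [a|h]; case: y => [c|h'] /= rMh.
  + case/or3P => [/andP[/eqP-> _]|/eqP->|/eqP->]; first lia.
      rewrite mulSn; case: ifP; lia.
    rewrite mulSn; lia.
  + by case/orP => [/eqP->|/andP[/eqP-> ->]]; rewrite ?mulSn; lia.
  + have := leq_ltn_trans (lr' h) (rMh h) => lM.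
    by case/orP => [/eqP->|/andP[/eqP-> _]]; rewrite ?mulSn; lia.
  + by case/andP=> /eqP-> /(elr _ _ (in_setT _) (in_setT _)); rewrite leq_add2l.
- move=> t; pose q := t %/ P; pose c := t %% P.
  have tE : t = q * P + c by exact: divn_eq.
  have cP : c < P by exact: ltn_pmod.
  pose blk i (D : {set 'I_k.+1 + H}) :=
    [set p : blocks | (val p.1 == i) && (p.2 \in D)].
  pose D1 : {set 'I_k.+1 + H} := inl @: [set: 'I_k.+1].
  pose D2 : {set 'I_k.+1 + H} := inl @: [set~ ord_max : 'I_k.+1].
  pose D3 : {set 'I_k.+1 + H} := inr @: bag l r [set: H] c.
  have cD1 : #|D1| = k.+1 by rewrite card_imset ?cardsT ?card_ord // => ? ? [].
  have cD2 : #|D2| = k by rewrite card_imset ?cardsC1 ?card_ord // => ? ? [].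
  have cD3 : #|D3| <= b by rewrite card_imset // => ? ? [].
  have inD1 a : inl a \in D1 by rewrite imset_f ?inE.
  have inD2 a : (inl a \in D2) = (a < k).
    rewrite mem_imset ?inE; last by move=> ? ? [].
    by rewrite -val_eqE /=; have := ltn_ord a; lia.
  have inD3 h : (inr h \in D3) = (l h <= c <= r h).
    by rewrite mem_imset ?inE // => ? ? [].
  have [cM|cM] := ltnP c M.
    apply: (@leq_trans #|blk q (D1 :|: D3) :|: blk q.+1 D2|).
      apply/subset_leq_card/subsetP => -[i x]; rewrite !inE /= /l' /r' tE /=.
      case: x => [a|h] /=.
        rewrite inD1 inD2 /=.
        case: (ltngtP i q) => [/mulP|qi|_]; rewrite ?andbT ?orbT //; first lia.
        case: (ltngtP i q.+1) => [|/mulP|->]; first lia.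
          by rewrite mulSn; case: ifP; lia.
        by rewrite mulSn; case: ifP; lia.
      have := rM h.
      case: (ltngtP i q) => [/mulP|/mulP|->]; [lia|lia|].
      by rewrite inD3 !leq_add2l => _ ->; rewrite orbT.
    rewrite (leq_trans (leq_card_setU _ _)) // leq_add //; last first.
      by rewrite -cD2; exact: card_in_block.
    apply: leq_trans (card_in_block _ _) _.
    by rewrite (leq_trans (leq_card_setU _ _)) // cD1 leq_add2l.
  (* At the reserved time two full spines may be alive, but no copy; [0 < b] pays for the extra
     spine vertex. *)
  apply: (@leq_trans #|blk q D1 :|: blk q.+1 D1|).
    apply/subset_leq_card/subsetP => -[i x]; rewrite !inE /= /l' /r' tE /=.
    case: x => [a|h] /=.
      rewrite !inD1 !andbT.
      case: (ltngtP i q) => [/mulP|qi|] //; first lia.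
      case: (ltngtP i q.+1) => [|/mulP|] //; first lia.
      by rewrite mulSn; case: ifP; lia.
    have := rM h.
    by case: (ltngtP i q) => [/mulP|/mulP|->]; lia.
  rewrite (leq_trans (leq_card_setU _ _)) //.
  have := card_in_block q D1; have := card_in_block q.+1 D1.
  rewrite cD1 /blk; lia.
Qed.

(** * Embedding by greedy cuts *)

Section GreedyEmbedding.
Variables (V : finType) (e : rel V) (l r : V -> nat) (W0 : {set V}).
Hypotheses (e_sym : symmetric e) (e_irrefl : irreflexive e) (l_inj : injective l).
Hypothesis model : interval_model e l r W0 k.+2.
(** Proper subsets suffice because the set placed in a copy always omits the vertex [x] that covers
    it; so [H] need only handle one vertex fewer. *)
Hypothesis embed_H : forall R : {set V}, R \proper W0 ->
  interval_model e l r R k.+1 -> exists g : V -> H, embedding e (@edge H) R g.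

Definition rank_in (W : {set V}) (v : V) : nat := #|[set w in W | l w < l v]|.

(** The third clause guarantees progress: each block receives some vertex, so as many blocks as
    vertices are enough. *)
Definition initial (W X : {set V}) : Prop :=
  [/\ X \subset W, #|X| <= k.+1, W != set0 -> X != set0
    & forall x w, x \in X -> w \in W -> w \notin X -> l x < l w].

Lemma rank_in_lt (W X : {set V}) (v : V) :
  initial W X -> v \in X -> rank_in W v < #|X|.
Proof.
case=> /subsetP XW _ _ ltX vX; apply/proper_card/properP; split.
  apply/subsetP=> w; rewrite inE => /andP[wW lwv]; apply: contraTT lwv => wX.
  by rewrite -leqNgt ltnW // ltX.
by exists v; rewrite // inE ltnn andbF.
Qed.

Lemma rank_in_mono (W : {set V}) (u v : V) :
  u \in W -> l u < l v -> rank_in W u < rank_in W v.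
Proof.
move=> uW luv; apply/proper_card/properP; split.
  by apply/subsetP=> w; rewrite !inE => /andP[-> /ltn_trans]; apply.
by exists u; rewrite inE ?ltnn ?andbF // uW.
Qed.

Lemma rank_in_inj (W : {set V}) : {in W &, injective (rank_in W)}.
Proof.
move=> u v uW vW uv.
case: (ltngtP (l u) (l v)) => [/(rank_in_mono uW)|/(rank_in_mono vW)|/l_inj //];
  by rewrite uv ltnn.
Qed.

(** If nothing crosses the cut, the next spine restarts with the remaining vertex of least left
    end. *)
Lemma initial_extension (W A : {set V}) :
  A \subset W -> #|A| <= k.+1 ->
  (forall x w, x \in A -> w \in W -> w \notin A -> l x < l w) ->
  exists2 X : {set V}, initial W X & A \subset X.
Proof.
move=> AW cA ltA; have [A0|An0] := eqVneq A set0; last by exists A.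
have [W_0|/set0Pn[w0 w0W]] := eqVneq W set0.
  by exists A => //; split; rewrite ?W_0 ?eqxx // -W_0.
have [m mW minm] := arg_minnP l w0W.
exists [set m]; last by rewrite A0 sub0set.
split; rewrite ?sub1set ?cards1 //.
  by move=> _; apply/set0Pn; exists m; rewrite inE.
move=> x w; rewrite !inE => /eqP-> wW wm; rewrite ltn_neqAle minm // andbT.
by apply: contraNneq wm => /l_inj->.
Qed.

(* [W] is the set of vertices not yet placed, and only its initial segment [X]
   has neighbours that are. *)
Lemma greedy_embedding (N : nat) (W X : {set V}) :
  #|W| <= N -> W \subset W0 -> initial W X ->
  exists f : V -> nat * block_vertex,
    [/\ embedding e block_edge W f,
        {in X, forall v, f v = (0, inl (inord (rank_in W v)))}
      & {in W, forall v, (f v).1 < N}].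
Proof.
have [lr elr cbag] := model.
have greedy0 M W1 X1 : W1 = set0 -> initial W1 X1 ->
    exists f : V -> nat * block_vertex,
      [/\ embedding e block_edge W1 f,
          {in X1, forall v, f v = (0, inl (inord (rank_in W1 v)))}
        & {in W1, forall v, (f v).1 < M}].
  move=> W_0 [+ _ _ _]; rewrite W_0 subset0 => /eqP->.
  exists (fun=> (0, inl ord0)); split; try by move=> v; rewrite inE.
  by split=> u v; rewrite inE.
elim: N W X => [|N IH] W X cW WW0 iniX.
  by apply: greedy0 => //; apply/eqP; rewrite -cards_eq0 -leqn0.
have [W_0|Wn0] := eqVneq W set0; first exact: greedy0.
have [XW cX Xn0 ltX] := iniX.
have /set0Pn[x0 x0X] := Xn0 Wn0.
have [x xX maxx] : exists2 x, x \in X & forall y, y \in X -> r y <= r x.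
  by case: (arg_maxnP r x0X) => x xX maxx; exists x.
have sXW := subsetP XW; have sW := subsetP WW0.
have xW := sXW _ xX; have xW0 := sW _ xW.
pose t := r x.
pose W' := [set w in W | t < r w].
pose R := [set w in W | (w \notin X) && (r w <= t)].
have W'W w : w \in W' -> w \in W by rewrite inE => /andP[].
have W'r w : w \in W' -> t < r w by rewrite inE => /andP[].
have XnW' w : w \in X -> w \notin W'.
  by move=> wX; rewrite inE negb_and -leqNgt maxx ?orbT.
have cW' : #|W'| <= N.
  rewrite -ltnS; apply: leq_trans cW; apply/proper_card/properP; split.
    exact/subsetP.
  by exists x => //; exact: XnW'.
have [X' iniX' AX'] : exists2 X', initial W' X' & [set w in W' | l w <= t] \subset X'.
  apply: initial_extension.
  - by apply/subsetP=> w /setIdP[].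
  - have : #|x |: [set w in W' | l w <= t]| <= k.+2.
      apply: leq_trans (cbag t); apply/subset_leq_card/subsetP => w.
      rewrite !inE => /predU1P[->|/andP[/andP[wW tw] lw]].
        by rewrite xW0 lr ?leqnn.
      by rewrite sW // lw ltnW.
    by rewrite cardsU1 inE (negPf (XnW' _ xX)).
  - move=> y w /setIdP[_ ly] wW'; rewrite inE wW' -ltnNge.
    exact: leq_ltn_trans.
have [X'W' cX' _ _] := iniX'; have sX'W' := subsetP X'W'.
have [f' [[injf' homf'] f'X' f'N]] := IH W' X' cW' (subset_trans (introT subsetP W'W) WW0) iniX'.
have RP w : w \in R -> [/\ w \in W, w \notin X & r w <= t].
  by rewrite inE => /and3P.
have RW0 w : w \in R -> w \in W0 by case/RP=> /sW.
have xR : x \notin R by rewrite inE xX andbF.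
have ltxR w : w \in R -> l x < l w by case/RP=> wW wX _; exact: ltX.
(* Every vertex of [R] starts after [x], as [X] is initial, and ends by [t = r x]. So [x] lies in
   each bag that meets [R], which lowers the bag bound by one. *)
have [||g [injg homg]] := @embed_H R.
- by apply/properP; split; [exact/subsetP|exists x].
- split.
  + by move=> v /RW0; exact: lr.
  + by move=> u v /RW0 uW0 /RW0; exact: elr.
  + move=> s; have [->|/set0Pn[w]] := eqVneq (bag l r R s) set0; first by rewrite cards0.
    rewrite inE => /andP[wR /andP[lws srw]]; rewrite -ltnS.
    apply: leq_trans (cbag s); apply/proper_card/properP; split.
      by apply/subsetP=> v /setIdP[/RW0 vW0 lrv]; rewrite inE vW0.
    exists x; last by rewrite inE (negPf xR).
    rewrite inE xW0 /= (leq_trans (ltnW (ltxR _ wR)) lws) /=.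
    by apply: leq_trans srw _; case/RP: wR.
pose f v : nat * block_vertex :=
  if v \in W' then ((f' v).1.+1, (f' v).2)
  else if v \in X then (0, inl (inord (rank_in W v))) else (0, inr (g v)).
have fW' v : v \in W' -> f v = ((f' v).1.+1, (f' v).2) by rewrite /f => ->.
have fX v : v \in X -> f v = (0, inl (inord (rank_in W v))).
  by move=> vX; rewrite /f (negPf (XnW' _ vX)) vX.
have RnW' v : v \in R -> v \notin W'.
  by case/RP=> _ _ rv; rewrite inE negb_and -leqNgt rv orbT.
have fR v : v \in R -> f v = (0, inr (g v)).
  by move=> vR; rewrite /f (negPf (RnW' _ vR)); case/RP: vR => _ /negPf->.
have caseW v : v \in W -> [\/ v \in W', v \in X | v \in R].
  move=> vW; have [vX|vX] := boolP (v \in X); first by constructor 2.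
  have [rv|rv] := leqP (r v) t; first by constructor 3; rewrite inE vW vX.
  by constructor 1; rewrite inE vW.
have rank_ord v : v \in X -> (inord (rank_in W v) : 'I_k.+1) = rank_in W v :> nat.
  by move=> vX; rewrite inordK // (leq_trans (rank_in_lt iniX vX)).
have rank_neq u v : u \in X -> v \in X ->
    inord (rank_in W u) = inord (rank_in W v) :> 'I_k.+1 -> u = v.
  move=> uX vX /(congr1 val); rewrite /= !rank_ord //.
  by apply: rank_in_inj; exact: sXW.
(* An edge leaving the first block ends in [X'], since [w] starts by [r u <= t]. Consecutive spines
   are fully joined, so the only issue is [u] in [R], where [w] must not take the last place of its
   spine. *)
have cross u w : u \in W -> u \notin W' -> w \in W' -> e u w -> block_edge (f u) (f w).
  move=> uW uW' wW' uw.
  have ru : r u <= t by move: uW'; rewrite inE uW -leqNgt.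
  have lw : l w <= r u by apply: elr; rewrite ?sW // ?W'W // e_sym.
  have wX' : w \in X'.
    by apply: (subsetP AX'); rewrite inE wW' (leq_trans lw).
  rewrite (fW' w) // f'X' //=.
  case: (caseW u uW) => [|uX|uR]; first by rewrite (negPf uW').
    by rewrite fX // /block_edge /= orbT.
  rewrite fR // /block_edge /= (inordK (leq_trans (rank_in_lt iniX' wX') cX')).
  (* Otherwise [u], [x], [w] and the [k] vertices before [w] share a bag. *)
  rewrite ltnNge; apply/negP => k_rank.
  pose S := [set v in W' | l v < l w].
  have : #|x |: (u |: (w |: S))| <= k.+2.
    apply: leq_trans (cbag (r u)); apply/subset_leq_card/subsetP => v.
    have lxu := ltxR _ uR; have lu := lr _ (sW _ uW).
    rewrite in_setU1 in_setU1 in_setU1 !inE => /or4P[/eqP->|/eqP->|/eqP->|].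
    - by rewrite xW0 ru andbT /= ltnW // (leq_trans lxu).
    - by rewrite sW //= lu leqnn.
    - by rewrite sW ?W'W //= lw (leq_trans ru) // ltnW // W'r.
    - case/andP=> /andP[vW tv] lv; rewrite sW //=.
      by rewrite (leq_trans (ltnW lv)) //= (leq_trans ru) // ltnW.
  rewrite !cardsU1 !in_setU1.
  have xw : x != w by apply: contraNneq (XnW' _ xX) => ->.
  have xu : x != u by apply: contraNneq xR => ->.
  have uw' : u != w by apply: contraNneq uW' => ->.
  have xS : x \notin S by rewrite inE (negPf (XnW' _ xX)).
  have uS : u \notin S by rewrite inE (negPf uW').
  have wS : w \notin S by rewrite inE ltnn andbF.
  rewrite (negPf xw) (negPf xu) (negPf uw') (negPf xS) (negPf uS) (negPf wS) /=.
  by rewrite !add1n !ltnS ltnNge k_rank.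
exists f; split=> //; first split.
- move=> u v uW vW.
  case: (caseW u uW) (caseW v vW) => [uW'|uX|uR] [vW'|vX|vR];
    rewrite ?(fW' _ uW') ?(fX _ uX) ?(fR _ uR) ?(fW' _ vW') ?(fX _ vX) ?(fR _ vR) //.
  + move=> [f1 f2]; apply: injf' => //.
    by rewrite [f' u]surjective_pairing [f' v]surjective_pairing f1 f2.
  + by case=> /rank_neq; apply.
  + by case=> /injg; apply.
- move=> u v uW vW uv.
  have [uW'|uW'] := boolP (u \in W'); have [vW'|vW'] := boolP (v \in W').
  + by have := homf' _ _ uW' vW' uv; rewrite (fW' u) // (fW' v).
  + by rewrite block_edge_sym; apply: cross; rewrite // e_sym.
  + exact: cross.
  + have le1 a b : a \in R -> b \in X -> block_edge (f a) (f b).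
      by move=> aR bX; rewrite fR // fX // /block_edge /=.
    case: (caseW u uW) (caseW v vW) => [uW2|uX|uR] [vW2|vX|vR];
      rewrite ?uW2 ?vW2 // in uW' vW'.
    * rewrite (fX u) // (fX v) // /block_edge /= !orbF.
      apply: contraTneq uv => /rank_neq-> //; by rewrite e_irrefl.
    * by rewrite block_edge_sym le1.
    * exact: le1.
    * by rewrite (fR u) // (fR v) // /block_edge /= homg.
- move=> v vW; case: (caseW v vW) => [vW'|vX|vR].
  + by rewrite fW' //= ltnS f'N.
  + by rewrite fX.
  + by rewrite fR.
Qed.

Lemma blocks_embedding :
  #|W0| <= n -> 0 < n -> exists f : V -> blocks, embedding e (@edge blocks) W0 f.
Proof.
move=> cW0 n0.
have [|||X iniX _] := @initial_extension W0 set0; rewrite ?sub0set ?cards0 //.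
  by move=> x w; rewrite inE.
have [f [[injf homf] _ fn]] := greedy_embedding cW0 (subxx _) iniX.
(* The remainder only makes [F] total; on [W0] the block index is already below [n]. *)
pose F v : blocks := (Ordinal (leq_trans (ltn_pmod (f v).1 n0) (leqnn n)), (f v).2).
have FE v : v \in W0 -> (val (F v).1, (F v).2) = f v.
  by move=> vW; rewrite /= modn_small ?fn // -surjective_pairing.
exists F; split=> u v uW vW.
  by move=> Fuv; apply: injf; rewrite // -!FE // Fuv.
by move=> uv; rewrite /= /blocks_edge !FE //; exact: homf.
Qed.

End GreedyEmbedding.
End Blocks.

(** * Induction on the width *)

(** This bounds the size of one block: a spine plus a copy of the smaller universal graph. The
    second binomial term of [(m.+1 + 1) ^ k.+1] already pays for the spine. *)
Lemma expnS_lower (k m : nat) : k.+1 + m.+1 ^ k.+1 <= m.+2 ^ k.+1.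
Proof.
elim: k => [|k IH]; first by rewrite !expn1.
rewrite (expnS m.+2) (expnS m.+1).
apply: leq_trans (leq_mul (leqnn m.+2) IH).
rewrite mulnDr; nia.
Qed.

Lemma universal_edgeless (m : nat) :
  exists U : sgraph,
    [/\ exists l r, interval_model (@edge U) l r [set: U] 1, #|U| = m.+1
      & forall (V : finType) (e : rel V) (W : {set V}),
          {in W &, forall u v, ~~ e u v} -> #|W| <= m.+1 ->
          exists f : V -> U, embedding e (@edge U) W f].
Proof.
have s0 : symmetric (fun _ _ : 'I_m.+1 => false) by [].
have i0 : irreflexive (fun _ _ : 'I_m.+1 => false) by [].
exists (SGraph s0 i0); split; first last.
- move=> V e W eW cW; exists (fun v => inord (index v (enum W))); split=> u v uW vW.
    have ind w : w \in W -> index w (enum W) < m.+1.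
      by move=> wW; rewrite (leq_trans _ cW) // cardE index_mem mem_enum.
    move=> /(congr1 val); rewrite /= !inordK ?ind // => /index_inj.
    by apply; rewrite ?mem_enum.
  by rewrite (negPf (eW _ _ uW vW)).
- by rewrite /= card_ord.
- exists (fun i : 'I_m.+1 => i : nat), (fun i : 'I_m.+1 => i : nat); split=> // t.
  have [tm|mt] := ltnP t m.+1.
    rewrite -(cards1 (Ordinal tm)); apply/subset_leq_card/subsetP => i.
    by rewrite !inE -eqn_leq -val_eqE.
  rewrite (_ : bag _ _ _ _ = set0) ?cards0 //; apply/setP => i; rewrite !inE.
  by have := ltn_ord i; lia.
Qed.

Lemma universal_interval_graph (k m : nat) :
  exists U : sgraph,
    [/\ exists l r, interval_model (@edge U) l r [set: U] (k ^ 2).+1,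
        #|U| <= m.+1 ^ k.+1
      & forall (V : finType) (e : rel V) (l r : V -> nat) (W : {set V}),
          symmetric e -> irreflexive e -> injective l ->
          interval_model e l r W k.+1 -> #|W| <= m.+1 ->
          exists f : V -> U, embedding e (@edge U) W f].
Proof.
elim: k m => [|k IH] m.
  have [U [modU cardU univU]] := universal_edgeless m.
  exists U; split=> [//||V e l r W e_sym e_irrefl l_inj [lr elr cbag] cW].
    by rewrite cardU expn1.
  apply: univU => // u v uW vW; apply/negP => uv.
  have luv : l u <= r v by exact: elr.
  have lvu : l v <= r u by apply: elr; rewrite // e_sym.
  (* Adjacent intervals are both alive at the later of their left ends, which bags of size one
     forbid. *)
  have sub : [set u; v] \subset bag l r W (maxn (l u) (l v)).
    apply/subsetP=> w; rewrite !inE geq_max leq_max => /orP[]/eqP->.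
      by rewrite uW leqnn lr.
    by rewrite vW leqnn orbT luv lr.
  have := leq_trans (subset_leq_card sub) (cbag _); rewrite cards2.
  by have -> : u != v by apply: contraTneq uv => ->; rewrite e_irrefl.
(* A single vertex is treated apart: its copies would have to be universal for zero vertices, which
   the form [m.+1] excludes. *)
case: m => [|m].
  have [U [[l [r [lr elr cbag]]] cardU univU]] := universal_edgeless 0.
  exists U; split=> [||V e l' r' W _ e_irrefl _ _ cW].
  - by exists l, r; split=> // t; apply: leq_trans (cbag t) _.
  - by rewrite cardU exp1n.
  - apply: univU => // u v uW vW.
    by have /card_le1_eqP/(_ _ _ uW vW)-> := cW; rewrite e_irrefl.
have [H [[l [r modH]] cardH univH]] := IH m.
exists (blocks k H m.+2); split.
- have [//|l' [r' mod']] := blocks_interval_model k m.+2 _ modH.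
  (* Each level adds [k.+1 + k], the difference of consecutive squares, to the bag size. *)
  exists l', r'; suff <- : k.+1 + (k ^ 2).+1 + k = (k.+1 ^ 2).+1 by []; lia.
- rewrite card_blocks expnS leq_mul2l /=.
  by apply: leq_trans (expnS_lower k m); rewrite leq_add2l.
- move=> V e l' r' W e_sym e_irrefl l'_inj modW cW.
  apply: (blocks_embedding e_sym e_irrefl l'_inj modW) => // R /proper_card cR modR.
  apply: univH modR _ => //.
  by rewrite -ltnS; apply: leq_trans cW.
Qed.

Theorem theorem3p5 (k n : nat) (hk : 0 < k) (hn : 0 < n) :
  exists U : sgraph,
    [/\ pathwidth U <= k ^ 2 + k - 1,
        #|U| <= n ^ k.+1
      & forall G : sgraph, #|G| = n -> pathwidth G <= k -> contains_subgraph U G].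
Proof.
case: n hn => // m _; have [U [[l [r modU]] cardU univU]] := universal_interval_graph k m.
exists U; split=> //; first by apply: leq_trans (pathwidth_leq modU) _; lia.
move=> G cG /interval_model_of_pathwidth[lG [rG [lG_inj modG]]].
have [|f emb] := univU _ _ _ _ _ (@edge_sym G) (@edge_irrefl G) lG_inj modG.
  by rewrite cardsT cG.
exact: contains_subgraph_of_embedding emb.
Qed.
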